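(* For $c\in\mathbb{C}$ let $CL_1(c)=\bigoplus_{i\geq -1}\mathbb{C}[\partial]L_i$ be the Lie conformal algebra, free as a $\mathbb{C}[\partial]$-module on $\{L_i\mid i\in\mathbb{Z},\ i\ge -1\}$, with the $\lambda$-bracket $$[{L_i}_\lambda L_j]=\big((i+1)\partial+(i+j+2)\lambda\big)L_{i+j}+c(j-i)L_{i+j}\qquad\text{for all } i,j\geq -1.$$ Then $CL_1(c)$ is a simple Lie conformal algebra for every $c\in\mathbb{C}$.
   Context: A Lie conformal algebra is a $\mathbb{C}[\partial]$-module $R$ with a $\mathbb{C}$-bilinear $\lambda$-bracket $[\cdot_\lambda\cdot]:R\times R\to R[\lambda]=R\otimes\mathbb{C}[\lambda]$ such that for all $a,b,c\in R$: $[\partial a_\lambda b]=-\lambda[a_\lambda b]$ and $[a_\lambda\partial b]=(\lambda+\partial)[a_\lambda b]$; $[a_\lambda b]=-[b_{-\lambda-\partial}a]$; $[a_\lambda[b_\mu c]]=[[a_\lambda b]_{\lambda+\mu}c]+[b_\mu[a_\lambda c]]$. For subspaces $A,B\subset R$, $[A,B]$ is the $\mathbb{C}$-linear span of all coefficients (in powers of $\lambda$) of $[a_\lambda b]$, $a\in A$, $b\in B$. An ideal of $R$ is a $\mathbb{C}[\partial]$-submodule $I\subset R$ with $[R,I]\subset I$. $R$ is abelian if $[R,R]=0$, and simple if it is not abelian and its only ideals are $0$ and $R$. The $\lambda$-bracket given on the generators extends to the whole module by the identities $[\partial a_\lambda b]=-\lambda[a_\lambda b]$, $[a_\lambda\partial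 b]=(\lambda+\partial)[a_\lambda b]$. For $i=j=-1$ all coefficients in the formula vanish, so the symbol $L_{-2}$ is read as $0$. *)

(* Defs.v *)
From HB Require Import structures.
From mathcomp Require Import all_boot all_order all_algebra.
From mathcomp Require Import finmap monalg complex.
From mathcomp Require Import classical_sets reals.

Set Implicit Arguments.
Unset Strict Implicit.
Unset Printing Implicit Defensive.

Import Order.TTheory GRing.Theory Num.Theory.

Local Open Scope classical_set_scope.
Local Open Scope ring_scope.

(* Conventions.  A K[d]-module is an lmodType V over {poly K}; d acts as 'X.
   V[lambda] is {malg V[nat]}, finitely supported functions nat -> V, f@_n
   being the coefficient of lambda^n; likewise V[lambda, mu] is
   {malg V[nat * nat]}.  In K[d][lambda] = {poly {poly K}}, the outer 'X is
   lambda and 'X%:P is d. *)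
Notation lampoly V := {malg V[nat]}.
Notation lammupoly V := {malg V[(nat * nat)%type]}.

Section LambdaPolynomials.
Variables (K : fieldType) (V : lmodType {poly K}).

Definition lam_const (v : V) : lampoly V := << v *g 0%N >>.

(* The K[d][lambda]-module structure of V[lambda] = V (x) K[lambda]. *)
Definition lam_act (P : {poly {poly K}}) (f : lampoly V) : lampoly V :=
  \sum_(n <- msupp f) \sum_(k < size P) << P`_k *: f@_n *g (k + n)%N >>.

(* f(Q), with the powers of Q in K[d][lambda] acting from the left on the
   coefficients of f; this is how [b_{-lambda-d} a] is to be read. *)
Definition lam_subst (Q : {poly {poly K}}) (f : lampoly V) : lampoly V :=
  \sum_(n <- msupp f) lam_act (Q ^+ n) (lam_const f@_n).

End LambdaPolynomials.

Section LieConformal.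
Variables (K : fieldType) (V : lmodType {poly K}).
Variable br : V -> V -> lampoly V.

(* [a_lambda [b_mu c]] *)
Definition br_lam_mu (a b c : V) : lammupoly V :=
  \sum_(n <- msupp (br b c)) \sum_(m <- msupp (br a (br b c)@_n))
    << (br a (br b c)@_n)@_m *g (m, n) >>.

(* [b_mu [a_lambda c]] *)
Definition br_mu_lam (b a c : V) : lammupoly V :=
  \sum_(m <- msupp (br a c)) \sum_(n <- msupp (br b (br a c)@_m))
    << (br b (br a c)@_m)@_n *g (m, n) >>.

(* [[a_lambda b]_{lambda + mu} c], with (lambda + mu)^l expanded *)
Definition br_lam_lammu (a b c : V) : lammupoly V :=
  \sum_(k <- msupp (br a b)) \sum_(l <- msupp (br (br a b)@_k c))
    \sum_(i < l.+1)
      << (br (br a b)@_k c)@_l *+ 'C(l, i) *g ((k + i)%N, (l - i)%N) >>.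

Record lie_conformal : Prop := LieConformal {
  lc_linearl : forall (k : K) a a' b,
    br (k%:P *: a + a') b = lam_act k%:P%:P (br a b) + br a' b;
  lc_linearr : forall (k : K) a b b',
    br a (k%:P *: b + b') = lam_act k%:P%:P (br a b) + br a b';
  lc_sesquil : forall a b,
    br ('X *: a) b = lam_act (- 'X) (br a b);
  lc_sesquir : forall a b,
    br a ('X *: b) = lam_act ('X + 'X%:P) (br a b);
  lc_skew : forall a b,
    br a b = - lam_subst (- 'X - 'X%:P) (br b a);
  lc_jacobi : forall a b c,
    br_lam_mu a b c = br_lam_lammu a b c + br_mu_lam b a c
}.

Definition scalar_span (S : set V) : set V :=
  [set v | exists s : seq (K * V),
     (forall x, x \in s -> S x.2) /\ v = \sum_(x <- s) x.1%:P *: x.2].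

Definition bracket_set (A B : set V) : set V :=
  scalar_span [set v | exists a b n, [/\ A a, B b & v = (br a b)@_n]].

Definition lc_ideal (I : set V) : Prop :=
  submod_closed (mem I) /\ bracket_set setT I `<=` I.

Definition lc_abelian : Prop := bracket_set setT setT = [set 0].

Definition lc_simple : Prop :=
  ~ lc_abelian /\
  forall I : set V, lc_ideal I -> I = [set 0] \/ I = setT.

Definition simple_lie_conformal : Prop := lie_conformal /\ lc_simple.

End LieConformal.

Definition CL1_index := {i : int | -1 <= i}.

(* The free K[d]-module on the L_i, i >= -1. *)
Notation CL1 K := {malg {poly K}[CL1_index]}.

Section CL1.
Variables (K : fieldType) (c : K).

(* L_i, with L_i := 0 when i < -1 *)
Definition CL1_L (i : int) : CL1 K :=
  if insub i is Some j then << (j : CL1_index) >> else 0.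

(* (i+1) d + (i+j+2) lambda + c (j-i) *)
Definition CL1_coef (i j : int) : {poly {poly K}} :=
  'X%:P *~ (i + 1) + 'X *~ (i + j + 2) + (c * (j - i)%:~R)%:P%:P.

(* p(d) L_i and q(d) L_j are sent to
   p(-lambda) q(lambda+d) [L_i _lambda L_j]. *)
Definition CL1_bracket (a b : CL1 K) : lampoly (CL1 K) :=
  \sum_(i <- msupp a) \sum_(j <- msupp b)
    lam_act (((a@_i)^:P \Po (- 'X)) * ((b@_j)^:P \Po ('X + 'X%:P))
               * CL1_coef (val i) (val j))
            (lam_const (CL1_L (val i + val j))).

Lemma CL1_bracketL (i j : int) : -1 <= i -> -1 <= j ->
  CL1_bracket (CL1_L i) (CL1_L j)
  = lam_act (CL1_coef i j) (lam_const (CL1_L (i + j))).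
Proof.
move=> i1 j1.
have LE (k : int) (k1 : -1 <= k) : CL1_L k = << (Sub k k1 : CL1_index) >>.
  by rewrite /CL1_L insubT.
rewrite /CL1_bracket (LE i i1) (LE j j1) !msuppU !oner_eq0 !big_seq_fset1 !mcoeffUU /=.
by rewrite !rmorph1 !mul1r.
Qed.

End CL1.

(* Main.v *)
(** Evaluate lambda-polynomials at points (d, l) of a commutative K-algebra A.
    With b_q(d) the coordinate of b along L_(q-1), the coordinate of
    [a_lambda b] along L_(k-1) becomes the sum over p + q = k + 1 of
    a_p(-l) b_q(l + d) C_pq(d, l), where C_pq is affine in p and q.  Coordinates
    evaluated in K[d][lambda], resp. K[d][mu][lambda], separate points, so that
    skew-symmetry and the Jacobi identity reduce to polynomial identities in
    p, q, r; the term L_(-2) is harmless since C_00 = 0.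

    Simplicity: if b_q has degree n, the coefficient of lambda^(n+1) in
    [L_(p-1) _lambda b] has along L_(p+q-2) the coordinate (p + q) lc(b_q), a
    nonzero constant.  Starting from b <> 0 in an ideal, L_(-1) repeatedly lowers
    the top index until b is a multiple of L_(-1); then bracketing with L_1 yields
    L_0, and [L_(p-1) _lambda L_0] yields every L_(p-1). *)
From HB Require Import structures.
Require Import Defs.
From mathcomp Require Import all_boot all_order all_algebra.
From mathcomp Require Import finmap monalg complex ring zify.
From mathcomp Require Import boolp classical_sets reals.

Set Implicit Arguments.
Unset Strict Implicit.
Unset Printing Implicit Defensive.

Import Order.TTheory GRing.Theory Num.Theory.

Local Open Scope ring_scope.

(** * Generators indexed by natural numbers *)

Fact CL1_idx_subproof (p : nat) : -1 <= p%:Z - 1.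
Proof. by lia. Qed.

(* [CL1_idx p] indexes L_(p-1). *)
Definition CL1_idx (p : nat) : CL1_index := Sub (p%:Z - 1) (CL1_idx_subproof p).

Definition CL1_unidx (i : CL1_index) : nat := absz (val i + 1).

Lemma CL1_unidxK : cancel CL1_unidx CL1_idx.
Proof. by move=> i; apply/val_inj; have := valP i; rewrite /CL1_unidx /=; lia. Qed.

Lemma CL1_idxK : cancel CL1_idx CL1_unidx.
Proof. by move=> p; rewrite /CL1_unidx /=; lia. Qed.

(** Replaces sums over supports, which vary with the element, by sums over a common range, so that
    they can be exchanged and compared term by term. *)
Lemma big_CL1_idx (A : nmodType) (s : seq CL1_index) (N : nat) (F : CL1_index -> A) :
    uniq s -> (forall i, i \notin s -> F i = 0) ->
    (forall p, (N <= p)%N -> F (CL1_idx p) = 0) ->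
  \sum_(i <- s) F i = \sum_(p < N) F (CL1_idx p).
Proof.
move=> us Fs FN.
rewrite -(big_mkord xpredT (F \o CL1_idx)) /= -(big_map CL1_idx xpredT F).
set r := map _ _.
have ur : uniq r by rewrite map_inj_uniq ?iota_uniq//; exact: can_inj CL1_idxK.
have Fr i : i \notin r -> F i = 0.
  rewrite -(CL1_unidxK i) mem_map ?mem_index_iota; last exact: can_inj CL1_idxK.
  by rewrite -leqNgt => /FN.
(* Both sums are cut down to the indices lying in [s] and in [r] at once. *)
rewrite (bigID [in r]) /= [X in _ + X]big1 ?addr0 => [|i /Fr//].
rewrite [RHS](bigID [in s]) /= [X in _ = _ + X]big1 ?addr0 => [|i /Fs//].
rewrite -big_filter -[RHS]big_filter; apply/perm_big/uniq_perm; rewrite ?filter_uniq//.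
by move=> i; rewrite !mem_filter andbC.
Qed.

(** * Evaluation of lambda-polynomials at points of a commutative algebra *)

Section Evaluation.
Variables (K : fieldType) (A : comNzRingType) (h : {rmorphism K -> A}).
Implicit Types (d l u : A) (p : {poly K}) (P Q : {poly {poly K}}).

Definition dpoly_eval d : {poly K} -> A :=
  horner_morph (fun x => mulrC d (h x)).
HB.instance Definition _ d := GRing.RMorphism.on (dpoly_eval d).

Definition dlpoly_eval d l : {poly {poly K}} -> A :=
  horner_morph (fun p => mulrC l (dpoly_eval d p)).
HB.instance Definition _ d l := GRing.RMorphism.on (dlpoly_eval d l).

Lemma dpoly_evalX d : dpoly_eval d 'X = d.
Proof. exact: horner_morphX. Qed.

Lemma dpoly_evalC d x : dpoly_eval d x%:P = h x.
Proof. exact: horner_morphC. Qed.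

Lemma dlpoly_evalX d l : dlpoly_eval d l 'X = l.
Proof. exact: horner_morphX. Qed.

Lemma dlpoly_evalC d l p : dlpoly_eval d l p%:P = dpoly_eval d p.
Proof. exact: horner_morphC. Qed.

Lemma dlpoly_eval_comp d l p Q :
  dlpoly_eval d l (p^:P \Po Q) = dpoly_eval (dlpoly_eval d l Q) p.
Proof.
elim/poly_ind: p => [|p x IH]; first by rewrite !rmorph0.
rewrite !(rmorphD, rmorphM) /= map_polyX comp_polyX map_polyC comp_polyC IH.
by rewrite dlpoly_evalC !dpoly_evalC dpoly_evalX.
Qed.

Lemma dlpoly_evalNX d l : dlpoly_eval d l (- 'X) = - l.
Proof. by rewrite rmorphN /= dlpoly_evalX. Qed.

Lemma dlpoly_evalXD d l : dlpoly_eval d l ('X + 'X%:P) = l + d.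
Proof. by rewrite rmorphD /= dlpoly_evalX dlpoly_evalC dpoly_evalX. Qed.

Lemma dlpoly_evalNXD d l : dlpoly_eval d l (- 'X - 'X%:P) = - l - d.
Proof. by rewrite -opprD rmorphN /= dlpoly_evalXD opprD. Qed.

Lemma dlpoly_eval_shifts d l p q P :
  dlpoly_eval d l ((p^:P \Po (- 'X)) * (q^:P \Po ('X + 'X%:P)) * P) =
  dpoly_eval (- l) p * dpoly_eval (l + d) q * dlpoly_eval d l P.
Proof.
rewrite 2!rmorphM /= 2!dlpoly_eval_comp.
by congr (dpoly_eval _ p * dpoly_eval _ q * _); rewrite (dlpoly_evalNX, dlpoly_evalXD).
Qed.

Lemma dlpoly_evalE d l P :
  dlpoly_eval d l P = \sum_(k < size P) dpoly_eval d P`_k * l ^+ k.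
Proof.
rewrite /dlpoly_eval /horner_morph (horner_coef_wide _ (size_poly _ _)).
by apply: eq_bigr => i _; rewrite coef_map.
Qed.

Section Lampoly.
Context {I : choiceType}.
Implicit Types (f g : lampoly {malg {poly K}[I]}) (v : {malg {poly K}[I]}).

Definition mc_eval (k : I) d : {malg {poly K}[I]} -> A :=
  dpoly_eval d \o mcoeff k.
HB.instance Definition _ k d := GRing.Additive.on (mc_eval k d).

Definition lam_eval (k : I) d l : lampoly {malg {poly K}[I]} -> A :=
  mmap (mc_eval k d) (fun n => l ^+ n).
HB.instance Definition _ k d l := GRing.Additive.on (lam_eval k d l).

Lemma mc_evalZ k d p v : mc_eval k d (p *: v) = dpoly_eval d p * mc_eval k d v.
Proof. by rewrite /mc_eval /= mcoeffZ rmorphM. Qed.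

Lemma lam_evalE k d l f :
  lam_eval k d l f = \sum_(n <- msupp f) mc_eval k d f@_n * l ^+ n.
Proof. by []. Qed.

Lemma lam_evalU k d l v n : lam_eval k d l << v *g n >> = mc_eval k d v * l ^+ n.
Proof. exact: mmapU. Qed.

Lemma lam_eval_act k d l P f :
  lam_eval k d l (lam_act P f) = dlpoly_eval d l P * lam_eval k d l f.
Proof.
rewrite /lam_act raddf_sum /= (lam_evalE _ _ _ f) mulr_sumr.
apply: eq_bigr => n _; rewrite raddf_sum /= dlpoly_evalE mulr_suml.
by apply: eq_bigr => i _; rewrite lam_evalU mc_evalZ exprD mulrACA.
Qed.

Lemma lam_eval_const k d l v : lam_eval k d l (lam_const v) = mc_eval k d v.
Proof. by rewrite lam_evalU mulr1. Qed.

(** Substitution only moves the point: [l] becomes the value of [Q], while [d] stays. *)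
Lemma lam_eval_subst k d l Q f :
  lam_eval k d l (lam_subst Q f) = lam_eval k d (dlpoly_eval d l Q) f.
Proof.
rewrite /lam_subst raddf_sum /= lam_evalE; apply: eq_bigr => n _.
by rewrite lam_eval_act lam_eval_const rmorphXn mulrC.
Qed.

Definition lammu_eval (k : I) d l u : lammupoly {malg {poly K}[I]} -> A :=
  mmap (mc_eval k d) (fun x => l ^+ x.1 * u ^+ x.2).
HB.instance Definition _ k d l u := GRing.Additive.on (lammu_eval k d l u).

Lemma lammu_evalU k d l u v x :
  lammu_eval k d l u << v *g x >> = mc_eval k d v * (l ^+ x.1 * u ^+ x.2).
Proof. exact: mmapU. Qed.

Section Bracket.
Variable br : {malg {poly K}[I]} -> {malg {poly K}[I]} -> lampoly {malg {poly K}[I]}.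

Lemma lammu_eval_br_lam_mu k d l u x y z :
  lammu_eval k d l u (br_lam_mu br x y z) =
  \sum_(n <- msupp (br y z)) lam_eval k d l (br x (br y z)@_n) * u ^+ n.
Proof.
rewrite raddf_sum; apply: eq_bigr => n _; rewrite lam_evalE raddf_sum /= mulr_suml.
by apply: eq_bigr => m _; rewrite lammu_evalU mulrA.
Qed.

Lemma lammu_eval_br_mu_lam k d l u x y z :
  lammu_eval k d l u (br_mu_lam br y x z) =
  \sum_(m <- msupp (br x z)) lam_eval k d u (br y (br x z)@_m) * l ^+ m.
Proof.
rewrite raddf_sum; apply: eq_bigr => n _; rewrite lam_evalE raddf_sum /= mulr_suml.
by apply: eq_bigr => m _; rewrite lammu_evalU mulrAC mulrA.
Qed.

(** Exchanging lambda and mu lets one formula serve both nested brackets of the Jacobi identity in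
    which the inner bracket is on the right. *)
Lemma lammu_eval_br_swap k d l u x y z :
  lammu_eval k d l u (br_mu_lam br y x z) = lammu_eval k d u l (br_lam_mu br y x z).
Proof.
exact: etrans (lammu_eval_br_mu_lam _ _ _ _ _ _ _) (esym (lammu_eval_br_lam_mu _ _ _ _ _ _ _)).
Qed.

(** The binomial sum in [br_lam_lammu] folds back into a power of [l + u], so the outer bracket is
    evaluated at [l + u]. *)
Lemma lammu_eval_br_lam_lammu k d l u x y z :
  lammu_eval k d l u (br_lam_lammu br x y z) =
  \sum_(m <- msupp (br x y)) lam_eval k d (l + u) (br (br x y)@_m z) * l ^+ m.
Proof.
rewrite raddf_sum; apply: eq_bigr => m _; rewrite lam_evalE raddf_sum /= mulr_suml.
apply: eq_bigr => n _; rewrite raddf_sum /= addrC exprDn mulr_sumr mulr_suml.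
apply: eq_bigr => i _; rewrite lammu_evalU raddfMn /= exprD !mulrnAl !mulrnAr ?mulrnAl.
by congr (_ *+ _); ring.
Qed.

End Bracket.

End Lampoly.
End Evaluation.

(** * Generic points separate lambda-polynomials *)

Section Separation.
Variables (K : fieldType) (I : choiceType).

Lemma dpoly_eval_polyC (A : comNzRingType) (h : {rmorphism K -> A}) (d : A) p :
  dpoly_eval (polyC \o h) d%:P p = (dpoly_eval h d p)%:P.
Proof.
elim/poly_ind: p => [|p x IH]; first by rewrite !rmorph0.
by rewrite !(rmorphD, rmorphM) /= !dpoly_evalC !dpoly_evalX IH.
Qed.

Lemma dpoly_evalXid (p : {poly K}) : dpoly_eval polyC 'X p = p.
Proof.
elim/poly_ind: p => [|p x IH]; first by rewrite !rmorph0.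
by rewrite !(rmorphD, rmorphM) /= !dpoly_evalC !dpoly_evalX IH.
Qed.

Local Notation h2 := (polyC \o polyC : K -> {poly {poly K}}).

(** At the generic point, with d and lambda the two variables of K[d][lambda], evaluation merely
    repackages the coordinates of [f]. *)
Lemma coef_lam_eval k (f : lampoly {malg {poly K}[I]}) n :
  (lam_eval h2 k 'X%:P 'X f)`_n = f@_n@_k.
Proof.
rewrite [in RHS](monalgE f) [in LHS](monalgE f) !raddf_sum /= !coef_sum.
apply: eq_bigr => m _; rewrite lam_evalU /mc_eval /= mcoeffU raddfMn /=.
rewrite (dpoly_eval_polyC polyC 'X) dpoly_evalXid.
by rewrite coefCM coefXn eq_sym; case: eqP; rewrite (mulr1, mulr0).
Qed.

Lemma lampoly_eqP (f g : lampoly {malg {poly K}[I]}) :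
    (forall k, lam_eval h2 k 'X%:P 'X f = lam_eval h2 k 'X%:P 'X g) ->
  f = g.
Proof.
by move=> fg; apply/malgP => n; apply/malgP => k; rewrite -!coef_lam_eval fg.
Qed.

Local Notation h3 := (polyC \o h2 : K -> {poly {poly {poly K}}}).

(** Same principle in K[d][mu][lambda]: lambda is the outermost variable, mu the middle one and d
    the innermost. *)
Lemma coef_lammu_eval k (f : lammupoly {malg {poly K}[I]}) m n :
  (lammu_eval h3 k 'X%:P%:P 'X 'X%:P f)`_m`_n = f@_(m, n)@_k.
Proof.
rewrite [in RHS](monalgE f) [in LHS](monalgE f) !raddf_sum /= !coef_sum.
apply: eq_bigr => -[m' n'] _; rewrite lammu_evalU /mc_eval /= mcoeffU raddfMn /=.
rewrite (dpoly_eval_polyC h2 'X%:P) (dpoly_eval_polyC polyC 'X) dpoly_evalXid.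
rewrite coefCM -rmorphXn coefMC coefXn xpair_eqE (eq_sym m') (eq_sym n').
case: eqP => _; last by rewrite mul0r mulr0 coef0.
by rewrite mul1r coefCM coefXn; case: eqP; rewrite (mulr1, mulr0).
Qed.

Lemma lammupoly_eqP (f g : lammupoly {malg {poly K}[I]}) :
    (forall k, lammu_eval h3 k 'X%:P%:P 'X 'X%:P f =
               lammu_eval h3 k 'X%:P%:P 'X 'X%:P g) ->
  f = g.
Proof.
by move=> fg; apply/malgP => -[m n]; apply/malgP => k; rewrite -!coef_lammu_eval fg.
Qed.

End Separation.

(* Reindexes by s = m - 1; [m = 0] has no such s, whence the condition on X. *)
Lemma sum_pred_index (A : comNzRingType) (N k p m : nat) (X : A) (F : A -> A) :
    (k.+1 < N)%N -> (m = 0%N -> X = 0) ->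
  \sum_(s < N) (X * F s%:R) *+ (m == s.+1) *+ (p + s == k.+1)%N =
  (X * F (m%:R - 1)) *+ (p + m == k.+2)%N.
Proof.
case: m => [|m] kN X0.
  by rewrite X0// mul0r mul0rn big1// => s _; rewrite mul0r !mul0rn.
rewrite addnS eqSS -natr1 addrK; case: eqP => [pm|pm].
  have mN : (m < N)%N by lia.
  rewrite (bigD1 (Ordinal mN)) //= eqxx pm eqxx big1 ?addr0// => s.
  by rewrite -val_eqE eqSS /= eq_sym => /negPf->; rewrite mul0rn.
rewrite big1// => s _; rewrite eqSS.
by case: (m =P s) => [<-|_]; [move/eqP/negPf: pm => -> | rewrite mul0rn].
Qed.

(** * Coordinates of the bracket, of its iterates and of its symmetries *)

Section CL1Bracket.
Variables (K : fieldType) (A : comNzRingType) (h : {rmorphism K -> A}) (c : K).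
Implicit Types (d l u : A) (a b : CL1 K) (k p q : nat).

(** [P] and [Q] stand for i + 1 and j + 1. They range over [A] rather than [nat] so that the index q
    + r - 1 of an inner bracket can be inserted without truncated subtraction. *)
Definition CL1_structure d l (P Q : A) : A :=
  P * d + (P + Q) * l + h c * (Q - P).

Lemma dlpoly_eval_coef d l (p q : nat) :
  dlpoly_eval h d l (CL1_coef c (val (CL1_idx p)) (val (CL1_idx q))) =
  CL1_structure d l p%:R q%:R.
Proof.
rewrite /CL1_coef /CL1_structure /= subrK.
have -> : p%:Z - 1 + (q%:Z - 1) + 2 = (p + q)%N by lia.
have -> : q%:Z - 1 - (p%:Z - 1) = q%:Z - p%:Z by lia.
apply: etrans (raddfD (dlpoly_eval h d l) _ _) _; congr (_ + _).
  apply: etrans (raddfD (dlpoly_eval h d l) _ _) _.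
  rewrite 2!raddfMz /= dlpoly_evalC dpoly_evalX dlpoly_evalX -!pmulrn.
  by rewrite -[d *+ _]mulr_natl -[l *+ _]mulr_natl natrD.
by rewrite /= dlpoly_evalC dpoly_evalC intrB rmorphM rmorphB /= !rmorph_nat.
Qed.

Lemma mc_eval_L k d (z : int) :
  mc_eval h (CL1_idx k) d (CL1_L K z) = (z == k%:Z - 1)%:R.
Proof.
rewrite /mc_eval /CL1_L; case: insubP => [i _ <-|] /=.
  by rewrite mcoeffU rmorphMn rmorph1 -val_eqE.
case: eqP => [->|_ _]; first by rewrite CL1_idx_subproof.
by rewrite mcoeff0 rmorph0.
Qed.

(** The points [- l] and [l + d] come from sesquilinearity. Since (p - 1) + (q - 1) = k - 1 means p
    + q = k + 1, any range containing k + 1 captures all nonzero terms. *)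
Lemma lam_eval_bracket N k d l a b : (k.+1 < N)%N ->
  lam_eval h (CL1_idx k) d l (CL1_bracket c a b) =
  \sum_(p < N) \sum_(q < N)
    (mc_eval h (CL1_idx p) (- l) a * mc_eval h (CL1_idx q) (l + d) b
       * CL1_structure d l p%:R q%:R) *+ (p + q == k.+1)%N.
Proof.
move=> kN; rewrite raddf_sum /=.
pose G i j := lam_eval h (CL1_idx k) d l
  (lam_act (((a@_i)^:P \Po (- 'X)) * ((b@_j)^:P \Po ('X + 'X%:P))
               * CL1_coef c (val i) (val j))
            (lam_const (CL1_L K (val i + val j)))).
have GE (p q : nat) : G (CL1_idx p) (CL1_idx q) =
    (mc_eval h (CL1_idx p) (- l) a * mc_eval h (CL1_idx q) (l + d) b
       * CL1_structure d l p%:R q%:R) *+ (p + q == k.+1)%N.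
  rewrite /G lam_eval_act lam_eval_const mc_eval_L dlpoly_eval_shifts.
  rewrite dlpoly_eval_coef.
  by rewrite mulr_natr; congr (_ *+ nat_of_bool _); apply/eqP/eqP => /=; lia.
under eq_bigr => i _ do rewrite raddf_sum /=.
rewrite (@big_CL1_idx _ _ N) ?fset_uniq// => [|i ia|p Np].
- apply: eq_bigr => p _; rewrite (@big_CL1_idx _ _ N) ?fset_uniq// => [|j jb|q Nq].
  + by apply: eq_bigr => q _; rewrite -GE.
  + by rewrite (mcoeff_outdom jb) lam_eval_act dlpoly_eval_shifts rmorph0 mulr0 !mul0r.
  + by rewrite -/(G _ _) GE; case: eqP => //; lia.
- rewrite big1// => j _.
  by rewrite (mcoeff_outdom ia) lam_eval_act dlpoly_eval_shifts rmorph0 !mul0r.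
- rewrite big1// => j _; rewrite -(CL1_unidxK j) -/(G _ _) GE.
  by case: eqP => //; lia.
Qed.

(** Here [f] is to be an inner bracket with its own variable [u]; by additivity the outer bracket
    sees it only through its evaluation with d replaced by [- l]. *)
Lemma lam_eval_bracketl N k d l u (f : lampoly (CL1 K)) b : (k.+1 < N)%N ->
  \sum_(n <- msupp f) lam_eval h (CL1_idx k) d l (CL1_bracket c f@_n b) * u ^+ n =
  \sum_(p < N) \sum_(q < N)
    (lam_eval h (CL1_idx p) (- l) u f * mc_eval h (CL1_idx q) (l + d) b
       * CL1_structure d l p%:R q%:R) *+ (p + q == k.+1)%N.
Proof.
move=> kN.
under eq_bigr => n _ do rewrite (lam_eval_bracket _ _ _ _ kN) mulr_suml.
rewrite exchange_big; apply: eq_bigr => p _.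
under eq_bigr => n _ do rewrite mulr_suml.
rewrite exchange_big; apply: eq_bigr => q _.
rewrite lam_evalE !mulr_suml -sumrMnl; apply: eq_bigr => n _.
by rewrite mulrnAl; congr (_ *+ _); ring.
Qed.

Lemma lam_eval_bracketr N k d l u a (f : lampoly (CL1 K)) : (k.+1 < N)%N ->
  \sum_(n <- msupp f) lam_eval h (CL1_idx k) d l (CL1_bracket c a f@_n) * u ^+ n =
  \sum_(p < N) \sum_(q < N)
    (mc_eval h (CL1_idx p) (- l) a * lam_eval h (CL1_idx q) (l + d) u f
       * CL1_structure d l p%:R q%:R) *+ (p + q == k.+1)%N.
Proof.
move=> kN.
under eq_bigr => n _ do rewrite (lam_eval_bracket _ _ _ _ kN) mulr_suml.
rewrite exchange_big; apply: eq_bigr => p _.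
under eq_bigr => n _ do rewrite mulr_suml.
rewrite exchange_big; apply: eq_bigr => q _.
rewrite lam_evalE mulr_sumr !mulr_suml -sumrMnl; apply: eq_bigr => n _.
by rewrite mulrnAl; congr (_ *+ _); ring.
Qed.

Lemma CL1_structure_eq0 d l p q : (p + q)%N = 0%N -> CL1_structure d l p%:R q%:R = 0.
Proof. by case: p q => [|p] [|q] //= _; rewrite /CL1_structure; ring. Qed.

(** The inner bracket lies along L_(s-1) with q + r = s + 1, so the sum over [s] collapses to s = q
    + r - 1. *)
Lemma lammu_eval_bracketr N k d l u x y z : (k.+2 < N)%N ->
  lammu_eval h (CL1_idx k) d l u (br_lam_mu (CL1_bracket c) x y z) =
  \sum_(p < N) \sum_(q < N) \sum_(r < N)
    (mc_eval h (CL1_idx p) (- l) x * (mc_eval h (CL1_idx q) (- u) y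
       * mc_eval h (CL1_idx r) (l + u + d) z * CL1_structure (l + d) u q%:R r%:R)
       * CL1_structure d l p%:R ((q + r)%:R - 1)) *+ (p + (q + r) == k.+2)%N.
Proof.
move=> kN; have kN' : (k.+1 < N)%N by lia.
rewrite lammu_eval_br_lam_mu (lam_eval_bracketr _ _ _ _ _ kN').
apply: eq_bigr => p _.
transitivity (\sum_(s < N) \sum_(q < N) \sum_(r < N)
    (mc_eval h (CL1_idx p) (- l) x * (mc_eval h (CL1_idx q) (- u) y
       * mc_eval h (CL1_idx r) (l + u + d) z * CL1_structure (l + d) u q%:R r%:R)
       * CL1_structure d l p%:R s%:R) *+ (q + r == s.+1)%N *+ (p + s == k.+1)%N).
  apply: eq_bigr => s _.
  under eq_bigr => q _ do rewrite sumrMnl.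
  rewrite sumrMnl; case: eqP => [ps|]; last by rewrite !mulr0n.
  (* From p + s = k + 1 follows s + 1 <= k + 2, which is where the bound k + 2 < N is needed. *)
  rewrite (lam_eval_bracket (N := N)); last by lia.
  rewrite mulr_sumr mulr_suml; congr (_ *+ _); apply: eq_bigr => q _.
  rewrite mulr_sumr mulr_suml; apply: eq_bigr => r _.
  by rewrite mulrnAr mulrnAl addrA [u + l]addrC.
rewrite exchange_big; apply: eq_bigr => q _.
rewrite exchange_big; apply: eq_bigr => r _.
(* For q = r = 0 there is no such [s]; the structure coefficient vanishes, which is the convention
   L_(-2) = 0. *)
rewrite (@sum_pred_index _ N k p _ _ (CL1_structure d l p%:R) kN')// => qr.
by rewrite (CL1_structure_eq0 _ _ qr) !mulr0.
Qed.

Lemma lammu_eval_bracketl N k d l u x y z : (k.+2 < N)%N ->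
  lammu_eval h (CL1_idx k) d l u (br_lam_lammu (CL1_bracket c) x y z) =
  \sum_(p < N) \sum_(q < N) \sum_(r < N)
    ((mc_eval h (CL1_idx p) (- l) x * mc_eval h (CL1_idx q) (- u) y
       * CL1_structure (- (l + u)) l p%:R q%:R) * mc_eval h (CL1_idx r) (l + u + d) z
       * CL1_structure d (l + u) ((p + q)%:R - 1) r%:R) *+ (p + (q + r) == k.+2)%N.
Proof.
move=> kN; have kN' : (k.+1 < N)%N by lia.
rewrite lammu_eval_br_lam_lammu (lam_eval_bracketl _ _ _ _ _ kN').
(* The index [r] of [z] is moved outermost on both sides, leaving the intermediate index [s] to be
   eliminated inside. *)
rewrite exchange_big.
under [RHS]eq_bigr => p _ do rewrite exchange_big.
rewrite [RHS]exchange_big; apply: eq_bigr => r _.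
transitivity (\sum_(s < N) \sum_(p < N) \sum_(q < N)
    ((mc_eval h (CL1_idx p) (- l) x * mc_eval h (CL1_idx q) (- u) y
       * CL1_structure (- (l + u)) l p%:R q%:R) * mc_eval h (CL1_idx r) (l + u + d) z
       * CL1_structure d (l + u) s%:R r%:R) *+ (p + q == s.+1)%N *+ (r + s == k.+1)%N).
  apply: eq_bigr => s _.
  under eq_bigr => q _ do rewrite sumrMnl.
  rewrite sumrMnl addnC; case: eqP => [ps|]; last by rewrite !mulr0n.
  rewrite (lam_eval_bracket (N := N)); last by lia.
  rewrite !mulr_suml; congr (_ *+ _); apply: eq_bigr => p _.
  rewrite !mulr_suml; apply: eq_bigr => q _.
  by rewrite !mulrnAl opprD (addrA l) subrr add0r.
rewrite [LHS]exchange_big; apply: eq_bigr => p _.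
rewrite [LHS]exchange_big; apply: eq_bigr => q _.
have /= sumE := @sum_pred_index A N k r _ _ (fun s => CL1_structure d (l + u) s r%:R) kN'.
rewrite sumE => [|pq]; first by rewrite [(r + _)%N]addnC addnA.
by rewrite (CL1_structure_eq0 _ _ pq) mulr0 mul0r.
Qed.

(** All three terms carry the same factor x_p(-l) y_q(-u) z_r(l+u+d) and the same constraint p + q +
    r = k + 2, so a polynomial identity between structure coefficients remains. *)
Lemma lammu_eval_jacobi k d l u x y z :
  lammu_eval h (CL1_idx k) d l u (br_lam_mu (CL1_bracket c) x y z) =
  lammu_eval h (CL1_idx k) d l u (br_lam_lammu (CL1_bracket c) x y z) +
  lammu_eval h (CL1_idx k) d l u (br_mu_lam (CL1_bracket c) y x z).
Proof.
have kN := ltnSn k.+2.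
apply: etrans (lammu_eval_bracketr d l u x y z kN) (esym _).
have El := lammu_eval_bracketl d l u x y z kN.
have Er := etrans (lammu_eval_br_swap h (CL1_bracket c) (CL1_idx k) d l u x y z)
                  (lammu_eval_bracketr d u l y x z kN).
apply: etrans (congr2 (fun s t => s + t) El Er) _.
rewrite [X in _ + X = _]exchange_big -big_split; apply: eq_bigr => p _.
rewrite -big_split; apply: eq_bigr => q _.
rewrite -big_split; apply: eq_bigr => r _ /=.
rewrite [(q + (p + r))%N]addnCA -mulrnDl [u + l]addrC !natrD.
by congr (_ *+ _); rewrite /CL1_structure; ring.
Qed.

(** Replacing [l] by [- l - d] exchanges the two points [- l] and [l + d]. *)
Lemma lam_eval_skew k d l x y :
  lam_eval h (CL1_idx k) d l (CL1_bracket c x y) =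
  - lam_eval h (CL1_idx k) d (- l - d) (CL1_bracket c y x).
Proof.
have kN := ltnSn k.+1.
apply: etrans (lam_eval_bracket d l x y kN) _.
apply: etrans _ (esym (congr1 -%R (lam_eval_bracket d (- l - d) y x kN))).
rewrite exchange_big -sumrN.
apply: eq_bigr => p _; rewrite -sumrN; apply: eq_bigr => q _.
rewrite opprD !opprK addrNK addnC -mulNrn.
by congr (_ *+ _); rewrite /CL1_structure; ring.
Qed.

(** Taking [t] in K[d] covers scalar linearity ([t] constant) and sesquilinearity ([t] equal to
    ['X]) together. *)
Lemma lam_eval_linearl k d l (t : {poly K}) x x' y :
  lam_eval h (CL1_idx k) d l (CL1_bracket c (t *: x + x') y) =
  dpoly_eval h (- l) t * lam_eval h (CL1_idx k) d l (CL1_bracket c x y) +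
  lam_eval h (CL1_idx k) d l (CL1_bracket c x' y).
Proof.
have kN := ltnSn k.+1.
apply: etrans (lam_eval_bracket d l (t *: x + x') y kN) (esym _).
apply: etrans (congr2 (fun e e' => dpoly_eval h (- l) t * e + e')
  (lam_eval_bracket d l x y kN) (lam_eval_bracket d l x' y kN)) (esym _).
rewrite mulr_sumr -big_split.
apply: eq_bigr => p _; rewrite mulr_sumr -big_split; apply: eq_bigr => q _ /=.
by rewrite mulrnAr -mulrnDl raddfD /= mc_evalZ; congr (_ *+ _); ring.
Qed.

Lemma lam_eval_linearr k d l (t : {poly K}) x y y' :
  lam_eval h (CL1_idx k) d l (CL1_bracket c x (t *: y + y')) =
  dpoly_eval h (l + d) t * lam_eval h (CL1_idx k) d l (CL1_bracket c x y) +
  lam_eval h (CL1_idx k) d l (CL1_bracket c x y').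
Proof.
have kN := ltnSn k.+1.
apply: etrans (lam_eval_bracket d l x (t *: y + y') kN) (esym _).
apply: etrans (congr2 (fun e e' => dpoly_eval h (l + d) t * e + e')
  (lam_eval_bracket d l x y kN) (lam_eval_bracket d l x y' kN)) (esym _).
rewrite mulr_sumr -big_split.
apply: eq_bigr => p _; rewrite mulr_sumr -big_split; apply: eq_bigr => q _ /=.
by rewrite mulrnAr -mulrnDl raddfD /= mc_evalZ; congr (_ *+ _); ring.
Qed.

End CL1Bracket.

(** * The Lie conformal axioms, and brackets with a generator *)

Section CL1Conformal.
Variables (K : fieldType) (c : K).
Local Notation h2 := (polyC \o polyC : K -> {poly {poly K}}).

Lemma CL1_bracket0l y : CL1_bracket c 0 y = 0.
Proof. by rewrite /CL1_bracket msupp0 big_seq_fset0. Qed.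

Lemma CL1_bracket0r x : CL1_bracket c x 0 = 0.
Proof. by rewrite /CL1_bracket big1// => i _; rewrite msupp0 big_seq_fset0. Qed.

Lemma CL1_lampoly_eqP (f g : lampoly (CL1 K)) :
    (forall k, lam_eval h2 (CL1_idx k) 'X%:P 'X f = lam_eval h2 (CL1_idx k) 'X%:P 'X g) ->
  f = g.
Proof. by move=> fg; apply: lampoly_eqP => i; rewrite -(CL1_unidxK i). Qed.

Lemma CL1_lie_conformal : lie_conformal (CL1_bracket c).
Proof.
split.
- move=> t x x' y; apply: CL1_lampoly_eqP => k.
  apply: etrans _ (esym (raddfD (lam_eval h2 (CL1_idx k) 'X%:P 'X) _ _)).
  rewrite lam_eval_linearl /= lam_eval_act.
  by rewrite dlpoly_evalC !dpoly_evalC.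
- move=> t x y y'; apply: CL1_lampoly_eqP => k.
  apply: etrans _ (esym (raddfD (lam_eval h2 (CL1_idx k) 'X%:P 'X) _ _)).
  rewrite lam_eval_linearr /= lam_eval_act.
  by rewrite dlpoly_evalC !dpoly_evalC.
- move=> x y; apply: CL1_lampoly_eqP => k.
  rewrite -['X *: x]addr0 lam_eval_linearl CL1_bracket0l raddf0 addr0.
  by rewrite lam_eval_act dlpoly_evalNX dpoly_evalX.
- move=> x y; apply: CL1_lampoly_eqP => k.
  rewrite -['X *: y]addr0 lam_eval_linearr CL1_bracket0r raddf0 addr0.
  by rewrite lam_eval_act dlpoly_evalXD dpoly_evalX.
- move=> x y; apply: CL1_lampoly_eqP => k.
  rewrite raddfN /= lam_eval_subst dlpoly_evalNXD.
  exact: lam_eval_skew.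
- move=> x y z; apply: lammupoly_eqP => i; rewrite -(CL1_unidxK i) raddfD /=.
  exact: lammu_eval_jacobi.
Qed.

Lemma mc_eval_gen (A : comNzRingType) (h : {rmorphism K -> A}) (d : A) p q :
  mc_eval h (CL1_idx q) d << CL1_idx p >> = (p == q)%:R.
Proof.
by rewrite /mc_eval /= mcoeffU rmorphMn rmorph1 (inj_eq (can_inj CL1_idxK)).
Qed.

Lemma lam_eval_bracket_gen k p (v : CL1 K) :
  lam_eval h2 (CL1_idx k) 'X%:P 'X (CL1_bracket c << CL1_idx p >> v) =
  \sum_(q < k.+2) (mc_eval h2 (CL1_idx q) ('X + 'X%:P) v
    * CL1_structure h2 c 'X%:P 'X p%:R q%:R) *+ (p + q == k.+1)%N.
Proof.
rewrite (lam_eval_bracket h2 c _ _ _ _ (ltnSn k.+1)) exchange_big.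
apply: eq_bigr => q _ /=.
have [pk|pk] := ltnP p k.+2.
  rewrite (bigD1 (Ordinal pk)) //= mc_eval_gen eqxx mul1r big1 ?addr0// => s.
  by rewrite mc_eval_gen -val_eqE eq_sym => /negPf/= ->; rewrite !mul0r mul0rn.
rewrite big1 => [|s _]; first by case: eqP => //; lia.
by rewrite mc_eval_gen; case: eqP => ps; rewrite ?mul0r ?mul0rn//; have := ltn_ord s; lia.
Qed.

Lemma coef_bracket_gen_eq0 p (v : CL1 K) k n :
    (forall q, (p + q = k.+1)%N -> v@_(CL1_idx q) = 0) ->
  ((CL1_bracket c << CL1_idx p >> v)@_n)@_(CL1_idx k) = 0.
Proof.
move=> v0; rewrite -coef_lam_eval lam_eval_bracket_gen big1 ?coef0// => q _.
by case: eqP => // /v0 vq; rewrite /mc_eval /= vq rmorph0 mul0r.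
Qed.

(** Writes r(lambda + d) as a composition, whose size and leading coefficient are computable. *)
Lemma dpoly_eval_shiftE (r : {poly K}) :
  dpoly_eval h2 ('X + 'X%:P) r = r^:P \Po ('X + 'X%:P).
Proof.
elim/poly_ind: r => [|r x IH]; first by rewrite !rmorph0.
rewrite !(rmorphD (dpoly_eval h2 _)) (rmorphM (dpoly_eval h2 _)) /= IH.
rewrite dpoly_evalX dpoly_evalC /= rmorphD rmorphM /= map_polyX map_polyC.
by rewrite comp_polyD comp_polyM comp_polyX comp_polyC.
Qed.

(** For a nonzero coordinate of degree n the [size] is n + 1, the top power of lambda in v_q(lambda
    + d) times a structure coefficient of degree at most one. *)
Lemma coef_bracket_gen_top p q k (v : CL1 K) : (p + q = k.+1)%N ->
  ((CL1_bracket c << CL1_idx p >> v)@_(size v@_(CL1_idx q)))@_(CL1_idx k) =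
  (k.+1%:R * lead_coef v@_(CL1_idx q))%:P.
Proof.
move=> pqk; rewrite -coef_lam_eval lam_eval_bracket_gen.
have qk : (q < k.+2)%N by lia.
rewrite (bigD1 (Ordinal qk)) //= pqk eqxx mulr1n big1 ?addr0 => [|s].
  rewrite -pqk; set r := v@_(CL1_idx q).
  have -> : CL1_structure h2 c 'X%:P 'X p%:R q%:R =
      'X * ((p + q)%:R : {poly K})%:P + ('X * p%:R + c%:P * (q%:R - p%:R))%:P.
    by rewrite /CL1_structure natrD /=; ring.
  rewrite /mc_eval /= -/r dpoly_eval_shiftE.
  set R := _ \Po _.
  have sX : size ('X + 'X%:P : {poly {poly K}}) = 2 by rewrite size_XaddC.
  have sR : size R = size r.
    by rewrite size_comp_poly2// size_map_inj_poly ?rmorph0//; apply: polyC_inj.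
  have lR : lead_coef R = (lead_coef r)%:P.
    rewrite lead_coef_comp ?sX// lead_coefXaddC expr1n mulr1.
    by rewrite lead_coef_map_inj ?rmorph0//; apply: polyC_inj.
  (* This removes the part of the structure coefficient free of lambda, hence all dependence on d
     and [c]. *)
  have R0 : R`_(size r) = 0 by rewrite nth_default ?sR.
  rewrite mulrDr coefD [X in _ + X]coefMC R0 mul0r addr0 mulrA coefMC coefMX.
  (* A zero coordinate is separate, as [size r] then has no predecessor; both sides are 0. *)
  have [r0|r0] := posnP (size r).
    rewrite /= mul0r; move/eqP: r0; rewrite size_poly_eq0 => /eqP->.
    by rewrite lead_coef0 mulr0.
  rewrite /= -sR -[R`__]/(lead_coef R) lR.
  by rewrite mulrC rmorphM rmorph_nat.
by rewrite -val_eqE -(eqn_add2l p) /= pqk => /negPf->; rewrite mulr0n.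
Qed.

End CL1Conformal.

Local Open Scope classical_set_scope.

(** * Closure properties of ideals *)

Section Ideals.
Variables (K : fieldType) (V : lmodType {poly K}) (br : V -> V -> lampoly V).
Implicit Types (I : set V).

Lemma bracket_set_coef (A B : set V) x y n :
  A x -> B y -> bracket_set br A B (br x y)@_n.
Proof.
move=> Ax By; exists [:: (1, (br x y)@_n)]; split; last by rewrite big_seq1 scale1r.
by move=> z; rewrite inE => /eqP->; exists x, y, n.
Qed.

Lemma lc_ideal_bracket I x y n : lc_ideal br I -> I y -> I (br x y)@_n.
Proof. by move=> [_ sub] Iy; apply: sub; apply: bracket_set_coef. Qed.

Lemma lc_ideal0 I : lc_ideal br I -> I 0.
Proof. by move=> [[I0 _] _]; rewrite -in_setE. Qed.

Lemma lc_ideal_linear I t u v : lc_ideal br I -> I u -> I v -> I (t *: u + v).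
Proof.
by move=> [[_ IL] _] Iu Iv; rewrite -in_setE; apply: IL; rewrite in_setE.
Qed.

End Ideals.

Lemma malgU_scale (I : choiceType) (A : nzRingType) (i : I) (r : A) :
  << r *g i >> = r *: << i >> :> {malg A[I]}.
Proof. by apply/malgP => j; rewrite mcoeffZ !mcoeffU mulrnAr mulr1. Qed.

(** * Simplicity in characteristic zero *)

Section CL1Simple.
Variables (K : fieldType) (c : K).
Hypothesis char0K : [pchar K] =i pred0.
Implicit Types (I : set (CL1 K)) (v w : CL1 K).
Local Notation br := (CL1_bracket c).
Local Notation gen p := (<< CL1_idx p >> : CL1 K).

Lemma natS_neq0 n : n.+1%:R != 0 :> K.
Proof. by rewrite ((pcharf0P _).1 char0K). Qed.

(** A nonzero constant, unlike a general polynomial in d, can be inverted in K[d]. *)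
Lemma lc_ideal_gen I w k (t : K) : lc_ideal br I -> I w -> t != 0 ->
    w@_(CL1_idx k) = t%:P -> (forall j, j != k -> w@_(CL1_idx j) = 0) ->
  I (gen k).
Proof.
move=> idI Iw t0 wk wj.
suff -> : gen k = (t^-1)%:P *: w + 0.
  by apply: (lc_ideal_linear _ idI) => //; apply: lc_ideal0 idI.
apply/malgP => i; rewrite addr0 mcoeffZ mcoeffU -(CL1_unidxK i).
rewrite (inj_eq (can_inj CL1_idxK)).
case: eqP => [<-|/eqP jk]; first by rewrite wk -polyCM mulVf.
by rewrite wj 1?eq_sym// mulr0.
Qed.

Lemma CL1_top v : v != 0 -> exists2 N, v@_(CL1_idx N) != 0 &
  forall q, (N < q)%N -> v@_(CL1_idx q) = 0.
Proof.
move=> v0; have [N vN] : exists N, v@_(CL1_idx N) != 0.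
  apply: contrapT => /forallNP vE; case/eqP: v0; apply/malgP => i.
  by rewrite -(CL1_unidxK i) mcoeff0; have /negP := vE (CL1_unidx i); rewrite negbK => /eqP.
have bd q : v@_(CL1_idx q) != 0 -> (q <= \max_(i <- msupp v) CL1_unidx i)%N.
  rewrite mcoeff_neq0 => qv; rewrite -[leqLHS]CL1_idxK.
  exact: (@leq_bigmax_seq _ _ xpredT CL1_unidx _ qv isT).
have exN : exists N, v@_(CL1_idx N) != 0 by exists N.
case: (ex_maxnP exN bd) => M vM maxM; exists M => // q Mq.
by apply/eqP; apply: contraTT Mq => /maxM; rewrite -leqNgt.
Qed.

(** Induction on the top index, each bracket with L_(-1) lowering it by exactly one. *)
Lemma lc_ideal_lowest I v : lc_ideal br I -> I v -> v != 0 ->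
  exists2 w, I w & w@_(CL1_idx 0) != 0 /\ forall q, (0 < q)%N -> w@_(CL1_idx q) = 0.
Proof.
move=> idI + /CL1_top[N]; elim: N v => [|N IH] v Iv vN vq; first by exists v.
pose w := (br (gen 0) v)@_(size v@_(CL1_idx N.+1)).
apply: (IH w); first exact: lc_ideal_bracket.
  rewrite (@coef_bracket_gen_top _ c 0 N.+1 N)// polyC_eq0 mulf_neq0 ?natS_neq0//.
  by rewrite lead_coef_eq0.
by move=> k Nk; apply: coef_bracket_gen_eq0 => q; rewrite add0n => ->; apply: vq.
Qed.

Lemma lc_ideal_full I v : lc_ideal br I -> I v -> v != 0 -> I = setT.
Proof.
move=> idI Iv v0; have [w Iw [w0 wq]] := lc_ideal_lowest idI Iv v0.
have I1 : I (gen 1).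
  pose t := 2%:R * lead_coef w@_(CL1_idx 0).
  (* With [w] a multiple of L_(-1), its bracket with L_1 lies along L_0 only, and its top
     coefficient is the constant [t]. *)
  apply: (@lc_ideal_gen I (br (gen 2) w)@_(size w@_(CL1_idx 0)) 1 t) => //.
  - exact: lc_ideal_bracket.
  - by rewrite mulf_neq0 ?natS_neq0// lead_coef_eq0.
  - exact: coef_bracket_gen_top.
  - by move=> j j1; apply: coef_bracket_gen_eq0 => q jq; apply: wq; lia.
have Ip p : I (gen p).
  (* The coefficient of lambda in [L_(p-1) _lambda L_0] is (p + 1) L_(p-1). *)
  apply: (@lc_ideal_gen I (br (gen p) (gen 1))@_1 p p.+1%:R) => //.
  - exact: lc_ideal_bracket.
  - exact: natS_neq0.
  - have := @coef_bracket_gen_top _ c p 1 p (gen 1) (addn1 p).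
    by rewrite mcoeffUU size_poly1 lead_coef1 mulr1.
  - move=> j jp; apply: coef_bracket_gen_eq0 => q jq.
    by rewrite mcoeffU (inj_eq (can_inj CL1_idxK)); case: eqP => //; lia.
apply/seteqP; split=> // u _; rewrite (monalgE u).
apply: (big_ind I); first exact: lc_ideal0 idI.
  by move=> x y Ix Iy; rewrite -[x]scale1r; apply: (lc_ideal_linear _ idI).
move=> i _; rewrite malgU_scale -(CL1_unidxK i) -[_ *: _]addr0.
exact: lc_ideal_linear _ idI (Ip _) (lc_ideal0 idI).
Qed.

Lemma CL1_simple : lc_simple br.
Proof.
split=> [ab|I idI].
  (* Witness of non-commutativity: the coefficient of lambda in [L_(-1) _lambda L_0] is L_(-1). *)
  have : bracket_set br setT setT (br (gen 0) (gen 1))@_1 by apply: bracket_set_coef.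
  rewrite ab => /(congr1 (mcoeff (CL1_idx 0))).
  have := @coef_bracket_gen_top _ c 0 1 0 (gen 1) erefl.
  rewrite mcoeffUU size_poly1 lead_coef1 mulr1 mcoeff0 => -> /eqP.
  by rewrite polyC_eq0; apply/negP/natS_neq0.
have [IE|/existsNP[v /not_implyP[Iv v0]]] := pselect (I `<=` [set 0]).
  by left; apply/seteqP; split=> // v ->; apply: lc_ideal0 idI.
by right; apply: lc_ideal_full Iv _ => //; apply/eqP.
Qed.

End CL1Simple.

Theorem theorem4p3 (R : realType) (c : R[i]) :
  simple_lie_conformal (CL1_bracket c).
Proof.
split; first exact: CL1_lie_conformal.
exact/CL1_simple/pchar_num.
Qed.
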